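(* For every $I\in\mathbb I$, $$\operatorname{add}(\mathcal M_I)=\operatorname{add}(\mathcal M)=\min\{\mathfrak b,\operatorname{minnon}(\vec{\mathcal M})\},$$ $$\operatorname{cof}(\mathcal M_I)=\operatorname{cof}(\mathcal M)=\max\{\mathfrak d,\operatorname{supcov}(\vec{\mathcal M})\}.$$
   Context: $\mathcal M$ is the ideal of meager subsets of ${}^\omega2$. $\mathfrak b$ and $\mathfrak d$ are the bounding and dominating numbers of $\langle{}^\omega\omega,\le^*\rangle$. $\forall^\infty n$ means ''for all but finitely many $n<\omega$''. $\mathbb I$ is the set of partitions $I=\langle I_n:n<\omega\rangle$ of $\omega$ into consecutive nonempty (finite) intervals. For $I,J\in\mathbb I$ and $y\in{}^\omega2$, $$A^I_{J,y}:=\{x\in{}^\omega2:\forall^\infty n<\omega\ \exists k<\omega\colon I_k\subseteq J_n\text{ and }x{\upharpoonright}I_k=y{\upharpoonright}I_k\},$$ and $\mathcal M_I:=\{X\subseteq{}^\omega2:\exists (J,y)\in\mathbb I\times{}^\omega2\colon X\subseteq A^I_{J,y}\}$, which is a $\sigma$-ideal on ${}^\omega2$. $\vec{\mathcal M}=\langle\mathcal M_I:I\in\mathbb I\rangle$. For an ideal $\mathcal I$ on ${}^\omega2$: $\operatorname{add}(\mathcal I)$ is the least size of $\mathcal J\subseteq\mathcal I$ with $\bigcup\mathcal J\notin\mathcal I$; $\operatorname{cov}(\mathcal I)$ is the least size of $\mathcal J\subseteq\mathcal I$ with $\bigcup\mathcal J={}^\omega2$; $\operatorname{non}(\mathcal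 I)$ is the least size of $A\subseteq{}^\omega2$ with $A\notin\mathcal I$; $\operatorname{cof}(\mathcal I)$ is the least size of a cofinal subset of $\langle\mathcal I,\subseteq\rangle$. $\operatorname{minnon}(\vec{\mathcal M}):=\min_{I\in\mathbb I}\operatorname{non}(\mathcal M_I)$ and $\operatorname{supcov}(\vec{\mathcal M}):=\sup_{I\in\mathbb I}\operatorname{cov}(\mathcal M_I)$. *)

(* Defs.v *)
From HB Require Import structures.
From mathcomp Require Import all_boot all_order.
From mathcomp Require Import boolp classical_sets functions cardinality filter.
From mathcomp Require Import topology cantor.
Set Implicit Arguments.
Unset Strict Implicit.
Unset Printing Implicit Defensive.
Import Order.TTheory.
Local Open Scope classical_set_scope.
Local Open Scope card_scope.

(* All the cardinals below are at most that of the power set of 2^omega. A    *)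
(* cardinal is thus represented by the class of all the subsets of this power *)
(* set that have that size, which makes equality of cardinals Leibniz         *)
(* equality (see [card_eqE]). The empty class is a top element, common to all *)
(* the larger sets, that plays no role here (see [fits_set], [fits_cantor],   *)
(* [fits_baire]). Equipotence classes of arbitrary types would not need such  *)
(* a bound, but they live in too large a universe for [set] to apply to them. *)
Record cardinal := Cardinal {
  card_class : set (set (set cantor_space));
  _ : exists (T : Type) (A : set T), card_class = [set B | B #= A] }.

Definition card T (A : set T) : cardinal :=
  Cardinal (ex_intro (fun T => exists A' : set T,
      [set B : set (set cantor_space) | B #= A] = [set B | B #= A']) T
    (ex_intro _ A erefl)).

Definition card_leq (c d : cardinal) : bool :=
  `[< forall D, card_class d D -> exists2 C, card_class c C & C #<= D >].

HB.instance Definition _ := gen_eqMixin cardinal.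
HB.instance Definition _ := gen_choiceMixin cardinal.

Definition fits T (A : set T) : Prop := A #<= [set: set cantor_space].

Lemma card_class_inj : injective card_class.
Proof.
move=> [C HC] [D HD] /= E; case: D / E HD => HD.
by rewrite (Prop_irrelevance HC HD).
Qed.

Lemma card_surj (c : cardinal) : exists (T : Type) (A : set T), c = card A.
Proof.
by case: c => C [T [A CA]]; exists T, A; apply: card_class_inj.
Qed.

Lemma fits_set (A : set (set cantor_space)) : fits A.
Proof. exact: card_leT. Qed.

Lemma fits_inj T (f : T -> set cantor_space) (A : set T) :
  injective f -> fits A.
Proof.
by move=> finj; apply/pcard_injP; exists f => x y _ _; exact: finj.
Qed.

Lemma fits_cantor (A : set cantor_space) : fits A.
Proof. by apply: (@fits_inj _ (@set1 _)) => x y /seteqP[/(_ x erefl)]. Qed.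

Lemma fits_baire (A : set (nat -> nat)) : fits A.
Proof.
pose e (p : nat * nat) : cantor_space := fun k => k == pickle p.
have einj : injective e.
  move=> p q /(congr1 (fun x : cantor_space => x (pickle p))).
  by rewrite /e eqxx => /esym/eqP/(pcan_inj pickleK).
apply: (@fits_inj _ (fun f => [set e (n, f n) | n in [set: nat]])) => f g fg.
apply/funext => n; have : [set e (n, f n) | n in [set: nat]] (e (n, f n)).
  by exists n.
by rewrite fg => -[m _ /einj[-> ->]].
Qed.

Lemma fitsP T (A : set T) : fits A <-> card_class (card A) !=set0.
Proof.
split=> [|[B /= BA]]; last by rewrite /fits -(card_le_eql BA); exact: card_leT.
by move=> /pcard_leTP[f]; exists (f @` A); exact: card_image.
Qed.

Lemma card_eqE T U (A : set T) (B : set U) :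
  fits A -> (card A = card B) <-> (A #= B).
Proof.
move=> /fitsP[C /= CA]; split=> [/(congr1 card_class) /= E|AB].
  have : [set B | B #= A] C by [].
  by rewrite E /= (card_eql CA).
by apply: card_class_inj; apply/seteqP; split=> V /=; rewrite (card_eqr AB).
Qed.

Lemma card_leqE T U (A : set T) (B : set U) :
  fits B -> card_leq (card A) (card B) = (A #<= B).
Proof.
move=> fB; have [D /= DB] := (fitsP _).1 fB.
apply/idP/idP => [/asboolP/(_ D DB)[C /= CA]|AB].
  by rewrite (card_le_eql CA) (card_le_eqr DB).
have [C /= CA] : card_class (card A) !=set0.
  by apply/fitsP; exact: card_le_trans fB.
apply/asboolP => D' /= D'B; exists C => //=.
by rewrite (card_le_eql CA) (card_le_eqr D'B).
Qed.

Lemma card_leq_top T U (A : set T) (B : set U) :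
  ~ fits B -> card_leq (card A) (card B).
Proof. by move=> fB; apply/asboolP => D DB; case: fB; apply/fitsP; exists D. Qed.

Lemma card_leq_refl : reflexive card_leq.
Proof. by move=> c; apply/asboolP => C; exists C. Qed.

Lemma card_leq_trans : transitive card_leq.
Proof.
move=> d c e /asboolP cd /asboolP de; apply/asboolP => E /de[D /cd[C Cc CD] DE].
by exists C => //; exact: card_le_trans DE.
Qed.

Lemma card_leq_anti : antisymmetric card_leq.
Proof.
move=> c d; have [T [A ->]] := card_surj c; have [U [B ->]] := card_surj d.
have [fB|fB] := pselect (fits B).
  rewrite card_leqE// => /andP[AB]; have fA : fits A by exact: card_le_trans fB.
  by rewrite card_leqE// => BA; apply/card_eqE => //; rewrite card_eq_le AB.
have [fA|fA _] := pselect (fits A).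
  by rewrite (card_leqE _ fA) => /andP[_ BA]; case: fB; exact: card_le_trans fA.
apply: card_class_inj; apply/seteqP.
by split=> D ?; [case: fA|case: fB]; apply/fitsP; exists D.
Qed.

Fact cardinal_display : Order.disp_t. Proof. exact: Order.Disp tt tt. Qed.

HB.instance Definition _ := Order.Le_isPOrder.Build cardinal_display cardinal
  card_leq_refl card_leq_anti card_leq_trans.

Lemma card_leE T U (A : set T) (B : set U) :
  fits B -> (card A <= card B)%O = (A #<= B).
Proof. exact: card_leqE. Qed.

(* Consider a maximal set F of elements of the product of representatives of  *)
(* S that pairwise differ in every coordinate: some coordinate projection is  *)
(* onto on F, and that coordinate is the least one.                           *)
Lemma cardinal_least (S : set cardinal) : S !=set0 -> (S `&` lbound S) !=set0.
Proof.
move=> [c0 Sc0]; pose I := {c | S c /\ card_class c !=set0}.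
have [[c1 Sc1]|noI] := pselect (exists c, S c /\ card_class c !=set0); last first.
  exists c0; split=> // d Sd; apply/asboolP => D dD; case: noI; exists d.
  by split=> //; exists D.
pose rep (i : I) : set (set cantor_space) := projT1 (cid (svalP i).2).
have repP i : card_class (sval i) (rep i) by exact: projT2 (cid (svalP i).2).
pose P : set (set (forall i, rep i)) :=
  [set F | forall i f g, F f -> F g -> f i = g i -> f = g].
have [|F [PF Fmax]] := @Zorn_bigcup _ P.
  move=> G GP Gtot i f g [X GX Xf] [Y GY Yg] fg.
  have [XY|YX] := Gtot _ _ GX GY; first by apply: (GP _ GY i) => //; apply: XY.
  by apply: (GP _ GX i) => //; apply: YX.
have [i iP] : exists i : I, forall y : rep i, exists f, F f /\ f i = y.
  apply: contrapT => /forallNP H.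
  have {}H i : exists y : rep i, forall f, F f -> f i <> y.
    have /existsNP[y /forallNP Hy] := H i; exists y => f Ff fy.
    exact: (Hy f).
  pose h i := projT1 (cid (H i)).
  have hP i f : F f -> f i <> h i.
    by rewrite /h; case: (cid (H i)) => y yP; exact: yP.
  apply: (Fmax (F `|` [set h])).
    split; first by move=> f; left.
    move=> /(_ h (or_intror erefl)) Fh.
    exact: (hP (exist _ c1 Sc1) h Fh).
  move=> i f g [Ff|->] [Fg|->] //; first exact: PF.
    by move/hP => /(_ Ff).
  by move/esym/hP => /(_ Fg).
exists (sval i); split=> [|d Sd]; first exact: (svalP i).1.
apply/asboolP => D dD; exists (rep i) => //.
pose j : I := exist _ d (conj Sd (ex_intro _ D dD)).
have jD : rep j #= D.
  have [T [A dA]] := card_surj d; have := repP j; have := dD.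
  by rewrite /= dA /= => DA jA; rewrite (card_eql jA) card_eq_sym.
rewrite -(card_le_eqr jD).
pose u (y : rep i) := projT1 (cid (iP y)).
have uP y : F (u y) /\ u y i = y by exact: projT2 (cid (iP y)).
apply/card_leP/injfunPex; exists (fun y => u y j) => //.
move=> y z _ _ /(PF j _ _ (uP y).1 (uP z).1) uyz.
by rewrite -(uP y).2 -(uP z).2 uyz.
Qed.

Lemma card_leq_total : total card_leq.
Proof.
move=> c d; have [|e [[->|->] le]] := @cardinal_least [set c; d].
- by exists c; left.
- by apply/orP; left; apply: (le d); right.
- by apply/orP; right; apply: (le c); left.
Qed.

HB.instance Definition _ :=
  Order.POrder_isTotal.Build cardinal_display cardinal card_leq_total.

Definition cardinal0 : cardinal := card (@set0 nat).

(* By [cardinal_least], the default value only matters for empty S.           *)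
Definition least (S : set cardinal) : cardinal :=
  xget cardinal0 (S `&` lbound S).

Lemma leastP (S : set cardinal) :
  S !=set0 -> S (least S) /\ forall c, S c -> (least S <= c)%O.
Proof.
by move=> /cardinal_least[c Sc]; rewrite /least; case: xgetP => [_ _ []//|/(_ c)].
Qed.

Lemma supcardinalP (S : set cardinal) :
  S !=set0 -> supremums S (supremum cardinal0 S).
Proof.
move=> S0; have [|c Sc] := @cardinal_least (ubound S).
  exists (card [set: set (set cantor_space)]) => c _.
  have [T [A ->]] := card_surj c; apply: card_leq_top; rewrite /fits => /pcard_leTP[f].
  pose D := [set f B | B in [set B | ~ B (f B)]].
  have [DfD|DfD] := pselect (D (f D)).
    by have [B BB /(inj (in_setT _) (in_setT _)) BD] := DfD; apply: BB; rewrite BD.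
  by apply: (DfD); exists D.
have /set0P/negPf S0' := S0.
by rewrite /supremum S0'; case: xgetP => // /(_ c).
Qed.

Section ideal_cardinals.
Variables (T : Type) (I : set (set T)).

Definition add : cardinal :=
  least [set card J | J in [set J | J `<=` I /\ ~ I (\bigcup_(X in J) X)]].

Definition cov : cardinal :=
  least [set card J | J in [set J | J `<=` I /\ \bigcup_(X in J) X = setT]].

Definition non : cardinal := least [set card A | A in ~` I].

Definition cof : cardinal :=
  least [set card J | J in
    [set J | J `<=` I /\ forall X, I X -> exists2 Y, J Y & X `<=` Y]].

End ideal_cardinals.

Definition nowhere_dense (T : topologicalType) (A : set T) : Prop :=
  interior (closure A) = set0.

Definition meager (T : topologicalType) (A : set T) : Prop :=
  exists F : nat -> set T,
    (forall n, nowhere_dense (F n)) /\ A `<=` \bigcup_n F n.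

Definition ideal_meager : set (set cantor_space) := [set A | meager A].

Definition le_star (f g : nat -> nat) : Prop :=
  \forall n \near \oo, (f n <= g n)%N.

Definition bounding : cardinal :=
  least [set card F | F in
    [set F : set (nat -> nat) | ~ exists g, forall f, F f -> le_star f g]].

Definition dominating : cardinal :=
  least [set card F | F in
    [set F : set (nat -> nat) | forall f, exists2 g, F g & le_star f g]].

Record interval_partition := IntervalPartition {
  block :> nat -> set nat;
  block_partition : partition [set: nat] block [set: nat];
  block_interval : forall n, exists a b, block n = [set i | (a <= i < b)%N];
  block_consecutive : forall n i j, block n i -> block n.+1 j -> (i < j)%N }.

Definition matching_set (I J : interval_partition) (y : cantor_space) :
    set cantor_space :=
  [set x : cantor_space | \forall n \near \oo,
    exists k, I k `<=` J n /\ forall i, I k i -> x i = y i].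

Definition ideal_match (I : interval_partition) : set (set cantor_space) :=
  [set X | exists J y, X `<=` matching_set I J y].

Definition minnon : cardinal := least (range (fun I => non (ideal_match I))).

Definition supcov : cardinal :=
  supremum cardinal0 (range (fun I => cov (ideal_match I))).

(* Main.v *)
From mathcomp Require Import all_boot all_order.
From mathcomp Require Import boolp classical_sets functions cardinality filter.
From mathcomp Require Import topology cantor.
Require Import Defs.

(** Write [A^I_(J, y)] for [matching_set I J y]. The point is that inclusion
    between such sets is, up to small modifications of the partitions, again an
    instance of matching: when [J] is a coarsening of [I],

    - if [y] is in [A^J_(J', y')], then [A^I_(J, y)] is included in
      [A^I_(J', y')] ([matching_set_trans]), by composing agreements;
    - if [A^I_(J, y)] is included in [A^I_(J', y')], then [y] is in
      [A^J_(J'', y')], where [J''] merges the blocks of [J'] two by two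
      ([matching_subset]).

    So an inclusion carries two pieces of information: most blocks of [J'']
    contain a block of [J], i.e. [J''] dominates [J], and [y] belongs to the
    set coded by [(J'', y')] in the ideal of [J]. Domination of partitions is
    the same as domination of functions ([le_star_dominated],
    [dominated_le_star]), whence [bounding] and [dominating]; the second piece,
    for varying [J], yields the [non] and [cov] of all the ideals at once,
    since a coarser [J] has a smaller ideal ([matching_set_antimono]).

    A bound for a family of pairs [(J, y)] is thus found in two steps, first a
    partition [K] dominating all the [J], then [(J', y')] such that all the [y]
    are in [A^K_(J', y')]; conversely, from a bound one reads off a bound for
    a family of functions, or a set of the ideal of any given partition that
    contains all the [y]. This computes the additivity of [ideal_match I] as
    the minimum of [bounding] and [minnon] ([add_ideal_match]) and, dually, its
    cofinality as the maximum of [dominating] and [supcov]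
    ([cof_ideal_match]). The upper bound on the cofinality comes from a family
    indexed by a dependent sum, whose size is controlled by the idempotence of
    infinite cardinals under multiplication ([card_le_square]).

    These values do not depend on [I], and the ideal of meager sets is itself
    [ideal_match I] for the partition [I] into singletons ([ideal_meagerE]). *)

Set Implicit Arguments.
Unset Strict Implicit.
Unset Printing Implicit Defensive.
Import Order.TTheory.
Local Open Scope classical_set_scope.
Local Open Scope card_scope.

(** * Interval partitions and their endpoints *)

Section IncreasingSequence.
Variable e : nat -> nat.
Hypothesis e_lt : forall n, e n < e n.+1.

Lemma increasing_leq : {mono e : m n / m <= n}.
Proof. by apply: leq_mono; apply: (homo_ltn ltn_trans). Qed.

Lemma increasing_ge n : n <= e n.
Proof. by elim: n => // n IHn; exact: leq_ltn_trans IHn (e_lt n). Qed.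

Lemma increasing_locate i : e 0 = 0 -> exists n, e n <= i < e n.+1.
Proof.
move=> e0; have ex : exists n, i < e n by exists i.+1; exact: increasing_ge.
case: (ex_minnP ex) => -[|n]; first by rewrite e0.
move=> lt_in least_n; exists n; rewrite lt_in andbT leqNgt.
by apply/negP => /least_n; rewrite ltnn.
Qed.

Lemma increasing_locate_inj m n i :
  e m <= i < e m.+1 -> e n <= i < e n.+1 -> m = n.
Proof.
move=> /andP[mi im] /andP[ni In]; apply/eqP; rewrite eqn_leq.
have := leq_ltn_trans mi In; have := leq_ltn_trans ni im.
by rewrite !ltnNge !increasing_leq -!ltnNge !ltnS => -> ->.
Qed.

End IncreasingSequence.

Lemma ends_exist (I : interval_partition) : exists e : nat -> nat,
  [/\ e 0 = 0, forall n, e n < e n.+1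
    & forall n i, I n i <-> e n <= i < e n.+1].
Proof.
have [cover_I _ I_neq0] := block_partition I.
have /choice[a /choice[b Iab]] := @block_interval I.
have ab n : a n < b n.
  have [i] := I_neq0 n Logic.I.
  by rewrite Iab /= => /andP[]; exact: leq_ltn_trans.
have bS n : b n <= a n.+1.
  have := ab n; case En : (b n) => [//|c] lt_ac.
  apply: (@block_consecutive I n); first by rewrite Iab /= En -ltnS lt_ac /=.
  by rewrite Iab /= leqnn ab.
have b_homo : {homo b : m n / m <= n}.
  apply: (homo_leq leqnn leq_trans) => // n.
  exact: leq_trans (bS n) (ltnW (ab _)).
have a_homo : {homo a : m n / m <= n}.
  apply: (homo_leq leqnn leq_trans) => // n.
  exact: leq_trans (ltnW (ab n)) (bS n).
have covered i : exists n, a n <= i < b n.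
  have : cover setT I i by rewrite cover_I.
  by move=> [n _]; rewrite Iab; exists n.
have a0 : a 0 = 0.
  have [n /andP[]] := covered 0; rewrite leqn0 => /eqP an0 _.
  by apply/eqP; rewrite -leqn0 -[leqRHS]an0; exact: a_homo.
have abE n : b n = a n.+1.
  apply/eqP; rewrite eqn_leq bS /= leqNgt; apply/negP => lt_ba.
  have [m /andP[am bm]] := covered (b n).
  have [le_mn|lt_nm] := leqP m n.
    by have := leq_trans bm (b_homo _ _ le_mn); rewrite ltnn.
  by have := leq_trans lt_ba (leq_trans (a_homo _ _ lt_nm) am); rewrite ltnn.
exists a; split=> // n; first by rewrite -abE.
by move=> i; rewrite Iab -abE.
Qed.

Definition ends (I : interval_partition) : nat -> nat :=
  projT1 (cid (ends_exist I)).

Section Ends.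
Variable I : interval_partition.

Lemma ends0 : ends I 0 = 0.
Proof. by rewrite /ends; case: cid => e []. Qed.

Lemma ends_ltS n : ends I n < ends I n.+1.
Proof. by rewrite /ends; case: cid => e []. Qed.

Lemma blockP n i : I n i <-> ends I n <= i < ends I n.+1.
Proof. by rewrite /ends; case: cid => e []. Qed.

Lemma leq_ends : {mono ends I : m n / m <= n}.
Proof. exact/increasing_leq/ends_ltS. Qed.

Lemma ends_ge n : n <= ends I n.
Proof. exact/increasing_ge/ends_ltS. Qed.

Lemma block_first n : I n (ends I n).
Proof. by apply/blockP; rewrite leqnn ends_ltS. Qed.

Lemma block_last n : I n (ends I n.+1).-1.
Proof.
apply/blockP; have := ends_ltS n.
by case: (ends I n.+1) => //= e; rewrite !ltnS leqnn andbT.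
Qed.

Lemma mem_block i : exists n, I n i.
Proof.
have [n ni] := increasing_locate ends_ltS i ends0.
by exists n; exact/blockP.
Qed.

Lemma block_inj m n i : I m i -> I n i -> m = n.
Proof.
by move=> /blockP mi /blockP ni; exact: (increasing_locate_inj ends_ltS mi ni).
Qed.

End Ends.

Lemma sub_block_ends (I J : interval_partition) k n :
  I k `<=` J n <-> ends J n <= ends I k /\ ends I k.+1 <= ends J n.+1.
Proof.
split=> [IJ|[le1 le2] i /blockP/andP[ki ik]].
  have /blockP/andP[-> _] := IJ _ (block_first I k).
  have /blockP/andP[_] := IJ _ (block_last I k).
  by rewrite prednK// (leq_ltn_trans _ (ends_ltS I k)).
by apply/blockP; rewrite (leq_trans le1 ki) (leq_trans ik le2).
Qed.

(** Turns late blocks of one partition into late blocks of another, which is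
    how statements holding for almost all blocks are composed. *)
Lemma sub_block_index (I J : interval_partition) N k n :
  I k `<=` J n -> ends I N <= n -> N <= k.
Proof.
move=> /sub_block_ends[JI _] Nn; rewrite -(leq_ends I).
exact: leq_trans Nn (leq_trans (ends_ge J n) JI).
Qed.

Lemma partition_of_ends (e : nat -> nat) : e 0 = 0 ->
  (forall n, e n < e n.+1) -> exists J : interval_partition, ends J =1 e.
Proof.
move=> e0 e_lt; pose B n := [set i | e n <= i < e n.+1].
have B_part : partition [set: nat] B [set: nat].
  split=> [|m n _ _ [i [mi ni]]|n _].
  - apply/seteqP; split=> // i _.
    by have [n ni] := increasing_locate e_lt i e0; exists n.
  - exact: (increasing_locate_inj e_lt mi ni).
  - by exists (e n); rewrite /B /= leqnn /=.
have B_int n : exists a b, B n = [set i | a <= i < b].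
  by exists (e n), (e n.+1).
have B_consec n i j : B n i -> B n.+1 j -> i < j.
  by move=> /andP[_ lt_i] /andP[le_j _]; exact: leq_trans lt_i le_j.
pose J := IntervalPartition B_part B_int B_consec; exists J.
have JB n i : (ends J n <= i < ends J n.+1) = (e n <= i < e n.+1).
  by apply/idP/idP => [/(blockP J)|?]; last exact/(blockP J).
move=> n; apply/eqP; rewrite eqn_leq.
have := JB n (e n); rewrite leqnn e_lt /= => /andP[-> _].
by have := JB n (ends J n); rewrite leqnn ends_ltS /= => /esym/andP[].
Qed.

(** * Coarsenings and domination *)

(** For partitions into intervals, this makes every block of [J] a union of
    blocks of [I] (see [refines_mem]). *)
Definition refines (I J : interval_partition) : Prop :=
  forall k, exists m, I k `<=` J m.

Lemma refines_mem (I J : interval_partition) m i :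
  refines I J -> J m i -> exists2 k, I k i & I k `<=` J m.
Proof.
move=> IJ Jmi; have [k Iki] := mem_block I i.
have [m' IkJ] := IJ k; exists k => //.
by rewrite (block_inj Jmi (IkJ _ Iki)).
Qed.

(** Any growth condition can be imposed on the blocks by merging enough
    consecutive blocks of [I]. Bounding [f] on all of [0, ends J n], and not
    only at [ends J n], spares any monotonicity assumption on [f]. *)
Lemma coarsening_exist (I : interval_partition) (f : nat -> nat) :
  exists J, refines I J /\
    forall n i, i <= ends J n -> f i <= ends J n.+1.
Proof.
pose next p := maxn p.+1 (\max_(i < (ends I p).+1) f i).
pose s n := iter n next 0.
have s_lt n : s n < s n.+1 by exact: leq_maxl.
have [||J Je] := @partition_of_ends (fun n => ends I (s n)).
- exact: ends0.
- by move=> n; rewrite ltnNge leq_ends -ltnNge.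
exists J; split=> [k|n i]; last rewrite !Je => le_i.
  have [m /andP[le_mk lt_km]] := increasing_locate s_lt k erefl; exists m.
  by apply/sub_block_ends; rewrite !Je !leq_ends.
apply: leq_trans (ends_ge I _); apply: leq_trans (leq_maxr _ _).
rewrite -ltnS in le_i.
exact: (@leq_bigmax _ (fun i : 'I_(ends I (s n)).+1 => f i) (Ordinal le_i)).
Qed.

Definition coarsening I f : interval_partition :=
  projT1 (cid (coarsening_exist I f)).

Lemma refines_coarsening I f : refines I (coarsening I f).
Proof. by rewrite /coarsening; case: cid => J []. Qed.

Lemma coarsening_ge I f n i :
  i <= ends (coarsening I f) n -> f i <= ends (coarsening I f) n.+1.
Proof. exact: (projT2 (cid (coarsening_exist I f))).2. Qed.

Definition dominated (J J' : interval_partition) : Prop :=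
  \forall n \near \oo, exists k, J k `<=` J' n.

(** This lemma and the next one translate between domination of functions and
    domination of partitions, by means of [n |-> ends J n.+1] in one direction
    and of [coarsening I] in the other. A block of [J] always lies in
    [[n, ends J n.+1[], since [ends J] is expansive. *)
Lemma le_star_dominated I J (g : nat -> nat) :
  le_star (fun n => ends J n.+1) g -> dominated J (coarsening I g).
Proof.
move=> [N _ Jg]; exists N => // n /= le_Nn.
set J' := coarsening I g; exists (ends J' n); apply/sub_block_ends.
split; first exact: ends_ge.
apply: leq_trans (coarsening_ge (leqnn _)); apply: Jg.
by apply: leq_trans (ends_ge _ _).
Qed.

Lemma dominated_le_star I J (f : nat -> nat) :
  dominated (coarsening I f) J -> le_star f (fun n => ends J n.+1).
Proof.
move=> [N _ fJ]; exists N => // n /= /fJ[k /sub_block_ends[le1 le2]].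
apply: leq_trans le2; apply: coarsening_ge.
exact: leq_trans (ends_ge J n) le1.
Qed.

(** * Inclusions between matching sets *)

Lemma matching_set_refl (I J : interval_partition) y :
  (forall n, exists k, I k `<=` J n) -> matching_set I J y y.
Proof. by move=> IJ; exists 0 => // n _; have [k] := IJ n; exists k. Qed.

(** Agreement on a block of [J] entails agreement on the block of [I] that it
    contains. *)
Lemma matching_set_antimono (I J K : interval_partition) y :
  (forall n, exists k, I k `<=` J n) ->
  matching_set J K y `<=` matching_set I K y.
Proof.
move=> IJ x [N _ xN]; exists N => // n /xN[m [JK xy]].
have [k IkJ] := IJ m; exists k; split=> [|i Iki]; last exact/xy/IkJ.
exact: subset_trans JK.
Qed.

Lemma matching_dominated (I J K : interval_partition) y x :
  matching_set I J y x -> dominated I J.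
Proof. by move=> [N _ xN]; exists N => // n /xN[k [IJ _]]; exists k. Qed.

(** Most blocks of [J'] contain a block of [K] on which [y] and [y'] agree, this
    block contains a block of [J], and the latter a block of [I] on which [x]
    and [y] agree. *)
Lemma matching_set_trans (I J K J' : interval_partition) y y' :
  dominated J K -> matching_set K J' y' y ->
  matching_set I J y `<=` matching_set I J' y'.
Proof.
move=> [N1 _ JK] [N2 _ KJ'] x [N3 _ IJ].
exists (maxn N2 (ends K (maxn N1 (ends J N3)))) => // n /=.
rewrite geq_max => /andP[/KJ'[m [KJ'm yy']]] le_n.
have := sub_block_index KJ'm le_n; rewrite geq_max => /andP[/JK[k JKk] le_m].
have [j [IJj xy]] := IJ _ (sub_block_index JKk le_m).
exists j; split=> [|i Iji]; first exact: subset_trans IJj (subset_trans JKk _).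
by rewrite xy// yy'//; apply/JKk/IJj.
Qed.

Lemma double_exist (J : interval_partition) :
  exists J', ends J' =1 fun n => ends J n.*2.
Proof.
by apply: partition_of_ends => [|n]; rewrite ?ends0// ltnNge leq_ends -ltnNge.
Qed.

Definition double J : interval_partition := projT1 (cid (double_exist J)).

Lemma ends_double J n : ends (double J) n = ends J n.*2.
Proof. by rewrite /double; case: cid. Qed.

(** The converse of [matching_set_trans], up to doubling. The inclusion is
    tested on a point [x] that agrees with [y] on one block [I (k m)] inside
    each [J m], and is opposite to [y'] elsewhere, so that [x] and [y'] can only
    match on the blocks [I (k m)], where [y] and [y'] then agree. Here [k m] is
    chosen such that [y] and [y'] differ on [I (k m)] whenever possible, and as
    the last block inside [J m] otherwise. Thus matches only happen in the
    second case, in which [y] and [y'] agree on all of [J m]: most blocks of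
    [J'] contain the last point of such a [J m], and two consecutive ones
    contain the whole of the second of the two [J m] obtained. *)
Lemma matching_subset (I J J' : interval_partition) (y y' : cantor_space) :
  refines I J -> matching_set I J y `<=` matching_set I J' y' ->
  matching_set J (double J') y' y.
Proof.
move=> IJ sub.
have kP m : exists k, I k `<=` J m /\
    ((forall i, I k i -> y i = y' i) ->
     I k (ends J m.+1).-1 /\ forall i, J m i -> y i = y' i).
  have [[k [IkJ neq]]|eq] :=
    pselect (exists k, I k `<=` J m /\ ~ forall i, I k i -> y i = y' i).
    by exists k; split.
  have [k Ikm IkJ] := refines_mem IJ (block_last J m).
  exists k; split=> // _; split=> // i Jmi.
  have [l Ili IlJ] := refines_mem IJ Jmi.
  apply: contrapT => yy'; apply: eq; exists l; split=> // /(_ _ Ili).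
  exact: yy'.
have /choice[k {}kP] := kP.
pose x : cantor_space :=
  fun i => if `[< exists m, I (k m) i >] then y i else ~~ y' i.
have /sub[N _ xN] : matching_set I J y x.
  exists 0 => // m _; exists (k m); split=> [|i Ii]; first exact: (kP m).1.
  by rewrite /x; case: asboolP => // -[]; exists m.
have lastP n : N <= n ->
    exists m, J' n (ends J m.+1).-1 /\ forall i, J m i -> y i = y' i.
  move=> /xN[l [IlJ' xy']].
  have := xy' _ (block_first I l); rewrite /x.
  case: asboolP => [[m Im] _|_ /eqP]; last by case: (y' _).
  have lk := block_inj (block_first I l) Im; rewrite {}lk in IlJ' xy'.
  have [] := (kP m).2 => [i Ii|Ilast eq_m].
    have := xy' _ Ii; rewrite /x; case: asboolP => // nk.
    by case: nk; exists m.
  by exists m; split=> //; exact: IlJ'.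
exists N => // n /= le_Nn.
have le_N2 : N <= n.*2 by rewrite (leq_trans le_Nn)// -addnn leq_addr.
(* The block [J m2] ends in [J' n.*2.+1], and starts after the end of [J m1],
   hence after the start of [J' n.*2]. *)
have [m1 [/blockP/andP[le1 lt1] _]] := lastP _ le_N2.
have [m2 [/blockP/andP[le2 lt2] eq2]] := lastP _ (leqW le_N2).
exists m2; split=> //; apply/sub_block_ends; rewrite !ends_double doubleS.
have succ m : (ends J m.+1).-1.+1 = ends J m.+1.
  by rewrite prednK// (leq_ltn_trans _ (ends_ltS J m)).
split; last by rewrite -succ.
apply: leq_trans le1 _; apply: leq_trans (leq_pred _) _; rewrite leq_ends.
have : (ends J m1.+1).-1 < (ends J m2.+1).-1 by exact: leq_trans lt1 le2.
by rewrite -ltnS !succ ltnNge leq_ends -ltnNge ltnS.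
Qed.

(** * Meager sets as matching sets *)

Definition cylinder (x : cantor_space) n : set cantor_space :=
  [set z : cantor_space | forall i, i < n -> z i = x i].

Lemma nbhs_cylinder (x : cantor_space) n : nbhs x (cylinder x n).
Proof.
elim: n => [|n IHn]; first by apply: filterS filterT => z _ i.
have nx : nbhs x ([set z : cantor_space | z n = x n]).
  have := @proj_continuous _ (fun _ : nat => bool) n x [set x n].
  by apply; exact: discrete_set1.
apply: filterS (filterI IHn nx) => z [zx zn] i.
by rewrite ltnS leq_eqVlt => /predU1P[->|/zx].
Qed.

(** Points [z n] that agree with [x] below [n] converge to [x], so they cannot
    all lie outside [U]. *)
Lemma nbhs_cylinder_sub (x : cantor_space) (U : set cantor_space) :
  nbhs x U -> exists n, cylinder x n `<=` U.
Proof.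
move=> Ux; apply: contrapT => /forallNP noU.
have /choice[z zP] n : exists z, cylinder x n z /\ ~ U z.
  by have /existsNP[z /not_implyP[? ?]] := noU n; exists z.
have zx : (z n : prod_topology (fun _ : nat => bool)) @[n --> \oo] --> x.
  apply/cvg_sup => i V; have /= -> := @nbhsE (initial_topology (@^~ i)) x.
  move=> [B [[C oC <-] /= Cx]] /filterS; apply; exists i.+1 => // n /= lt_in.
  by rewrite (zP n).1.
have [N _ zU] := zx _ Ux; case: (zP N) => _; apply; exact: zU (leqnn N).
Qed.

Lemma nowhere_denseP (F : set cantor_space) :
  nowhere_dense F <-> forall x n, exists y m, [/\ n <= m,
    cylinder x n y & forall z, cylinder y m z -> ~ F z].
Proof.
split=> [ndF x n|H].
  have /existsNP[y /not_implyP[xy nFy]] : ~ cylinder x n `<=` closure F.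
    move=> sub; have : interior (closure F) x.
      by apply: filterS sub _; exact: nbhs_cylinder.
    by rewrite ndF.
  have /existsNP[U /not_implyP[Uy FU]] := nFy.
  have [k kU] := nbhs_cylinder_sub Uy.
  exists y, (maxn n k); split=> [|//|z yz Fz]; first exact: leq_maxl.
  apply: FU; exists z; split=> //; apply: kU => i lt_ik; apply: yz.
  by rewrite leq_max lt_ik orbT.
apply/seteqP; split=> // x /nbhs_cylinder_sub[n nF].
have [y [m [_ /nF yF ym]]] := H x n.
by have [z [Fz /ym]] := yF _ (nbhs_cylinder y m).
Qed.

Lemma singletons_exist : exists I : interval_partition, ends I =1 id.
Proof. exact: partition_of_ends. Qed.

Definition singletons : interval_partition := projT1 (cid singletons_exist).

Lemma singletonsP k i : singletons k i <-> i = k.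
Proof.
have e := projT2 (cid singletons_exist).
rewrite blockP !e /= ltnS -eqn_leq; split=> [/eqP//|->]; exact: eqxx.
Qed.

(** The points matching [y] on all blocks from the [N]-th one form a nowhere
    dense set: it is avoided by being opposite to [y] on one far block. *)
Lemma meager_matching_set (J : interval_partition) y :
  meager (matching_set singletons J y).
Proof.
exists (fun N => [set x : cantor_space | forall n, N <= n ->
  exists2 i, J n i & x i = y i]); split=> [N|x [N _ xN]]; last first.
  exists N => // n /xN[k [kJ xy]]; exists k; [apply: kJ|apply: xy];
    exact/singletonsP.
apply/nowhere_denseP => x n; pose p := maxn n N.
pose z : cantor_space := fun i => if i < n then x i else ~~ y i.
exists z, (ends J p.+1); split=> [|i|w zw /(_ p)].
- by apply: leq_trans (ends_ge _ _); rewrite ltnW// ltnS leq_maxl.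
- by rewrite /z => ->.
move=> /(_ (leq_maxr _ _))[i /blockP/andP[le_i lt_i]].
have le_ni : n <= i.
  by apply: leq_trans (leq_trans (ends_ge J p) le_i); exact: leq_maxl.
rewrite zw// /z ltnNge le_ni /=.
by case: (y i).
Qed.

(** A single string [t] on [[a, b[] handles finitely many pairs (initial
    segment, nowhere dense set): it is extended once for each pair. *)
Lemma avoid_sequence (F : nat -> set cantor_space)
    (s : seq (cantor_space * nat)) a : (forall n, nowhere_dense (F n)) ->
  exists (t : cantor_space) b, a <= b /\ forall x j, (x, j) \in s ->
    forall z, (forall i, i < b -> z i = if i < a then x i else t i) -> ~ F j z.
Proof.
move=> ndF; elim: s => [|[x j] s [t [b [le_ab tb]]]].
  by exists point, a; split.
have /nowhere_denseP/(_ (fun i => if i < a then x i else t i) b) := ndF j.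
move=> [t' [c [le_bc tt' t'c]]].
exists t', c; split=> [|x' j']; first exact: leq_trans le_bc.
rewrite inE => /predU1P[[-> ->] z zt'|/tb H z zt'].
  apply: t'c => i lt_ic; rewrite zt'//; case: ifPn => // lt_ia.
  by rewrite tt' ?lt_ia// (leq_trans lt_ia le_ab).
apply: H => i lt_ib; rewrite zt' ?(leq_trans lt_ib le_bc)//.
by case: ifPn => // /negPf nia; rewrite tt'// nia.
Qed.

(** There are finitely many initial segments of length [a], so the string [t]
    can be made to work whatever [z] is below [a]. *)
Lemma avoid_block (F : nat -> set cantor_space) a :
  (forall n, nowhere_dense (F n)) ->
  exists (t : cantor_space) b, forall j z, j <= a ->
    (forall i, a <= i < b -> z i = t i) -> ~ F j z.
Proof.
move=> ndF; pose ext (w : a.-tuple bool) : cantor_space := nth false w.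
have [t [b [le_ab tb]]] := @avoid_sequence F
  [seq (ext p.1, val p.2) | p <- enum {: a.-tuple bool * 'I_a.+1}] a ndF.
exists t, b => j z le_ja zt.
pose w := [tuple z i | i < a].
apply: (tb (ext w) j).
  apply/mapP; exists (w, Ordinal (le_ja : j < a.+1)) => //.
  by rewrite mem_enum.
move=> i lt_ib; case: ifPn => [lt_ia|]; last first.
  by rewrite -leqNgt => le_ai; rewrite zt// le_ai.
by rewrite /ext -[i]/(val (Ordinal lt_ia)) -tnth_nth tnth_mktuple.
Qed.

(** Talagrand's characterization of meager sets: concatenating the strings given
    by [avoid_block], one obtains a point that differs from each element of a
    given meager set somewhere in almost every block. Having two digits only,
    to differ from it at some point of the block is to agree with the opposite
    point on a singleton. *)
Lemma ideal_meagerE : ideal_meager = ideal_match singletons.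
Proof.
apply/seteqP; split=> X /=; last first.
  move=> [J [y XA]]; have [F [ndF AF]] := meager_matching_set J y.
  by exists F; split=> //; exact: subset_trans AF.
move=> [F [ndF XF]].
have /choice[t /choice[b tb]] a := @avoid_block F a ndF.
pose J := coarsening singletons b.
have /choice[m mP] := mem_block J.
exists J, (fun i => ~~ t (ends J (m i)) i) => x /XF[j _ Fjx].
exists j => // n /= le_jn.
have [i [le_i lt_i xt]] : exists i, [/\ ends J n <= i, i < b (ends J n)
    & x i <> t (ends J n) i].
  apply: contrapT => noi; apply: (tb (ends J n) j x) => //.
    exact: leq_trans (ends_ge J n).
  by move=> i /andP[le_i lt_i]; apply: contrapT => xt; apply: noi; exists i.
have Jni : J n i.
  apply/blockP; rewrite le_i; apply: leq_trans lt_i _.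
  exact: coarsening_ge.
exists i; split=> [k /singletonsP -> //|k /singletonsP ->].
rewrite (block_inj (mP i) Jni); move: xt.
by case: (x i) (t _ i) => -[].
Qed.

(** * The square of an infinite cardinal *)

Lemma card_le_cases (A B : set (set cantor_space)) :
  (A #<= B) \/ (B #<= A).
Proof.
have /orP := card_leq_total (card A) (card B).
by rewrite !card_leqE; [|exact: fits_set|exact: fits_set].
Qed.

Section Hessenberg.
Variables (T : Type) (A : set T).

(** An injection of [pp_set `*` pp_set] into [pp_set]; the values of [pp_fun]
    outside of this square are junk, which [pp_extends] ignores. *)
Record partial_pairing := PartialPairing {
  pp_set : set T;
  pp_fun : T -> T -> T;
  pp_sub : pp_set `<=` A;
  pp_closed : forall a b, pp_set a -> pp_set b -> pp_set (pp_fun a b);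
  pp_inj : forall a b c d, pp_set a -> pp_set b -> pp_set c -> pp_set d ->
    pp_fun a b = pp_fun c d -> a = c /\ b = d }.

Definition pp_extends (p q : partial_pairing) : Prop :=
  pp_set p `<=` pp_set q /\
  forall a b, pp_set p a -> pp_set p b -> pp_fun q a b = pp_fun p a b.

Lemma pp_extends_refl p : pp_extends p p.
Proof. by split. Qed.

Lemma pp_extends_trans p q r :
  pp_extends p q -> pp_extends q r -> pp_extends p r.
Proof.
move=> [pq1 pq2] [qr1 qr2]; split=> [|a b pa pb]; first exact: subset_trans qr1.
by rewrite qr2 ?pq2//; exact: pq1.
Qed.

(** The union of a chain, glued by choosing for each pair of points a member of
    the chain that pairs them. *)
Lemma pp_chain (C : set partial_pairing) : C !=set0 -> total_on C pp_extends ->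
  exists q, forall p, C p -> pp_extends p q.
Proof.
move=> [p0 _] tot; pose B := \bigcup_(p in C) pp_set p.
pose good a b p := C p /\ (pp_set p a /\ pp_set p b).
have both p q : C p -> C q -> exists2 r, C r & pp_extends p r /\ pp_extends q r.
  move=> Cp Cq; have [pq|qp] := tot _ _ Cp Cq.
    by exists q => //; split=> //; exact: pp_extends_refl.
  by exists p => //; split=> //; exact: pp_extends_refl.
have goodP a b : B a -> B b -> exists p, good a b p.
  move=> [p Cp pa] [q Cq qb]; have [r Cr [pr qr]] := both _ _ Cp Cq.
  by exists r; split=> //; split; [exact: pr.1|exact: qr.1].
have /choice[g gP] (ab : T * T) :
    exists p, B ab.1 -> B ab.2 -> good ab.1 ab.2 p.
  have [[Ba Bb]|nB] := pselect (B ab.1 /\ B ab.2).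
    by have [p pP] := goodP _ _ Ba Bb; exists p.
  by exists p0 => Ba Bb; case: nB.
pose f a b := pp_fun (g (a, b)) a b.
have fE p a b : C p -> pp_set p a -> pp_set p b -> f a b = pp_fun p a b.
  move=> Cp pa pb; rewrite /f.
  have [||Cq [qa qb]] := gP (a, b); [by exists p|by exists p|].
  have [r Cr [pr qr]] := both _ _ Cp Cq.
  by rewrite -(pr.2 _ _ pa pb) -(qr.2 _ _ qa qb).
have subB : B `<=` A by move=> a [p _]; exact: pp_sub.
have clB a b : B a -> B b -> B (f a b).
  move=> Ba Bb; have [p [Cp [pa pb]]] := goodP _ _ Ba Bb.
  by exists p => //; rewrite (fE p)//; exact: pp_closed.
have injB a b c d : B a -> B b -> B c -> B d -> f a b = f c d -> a = c /\ b = d.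
  move=> Ba Bb Bc Bd; have [p [Cp [pa pb]]] := goodP _ _ Ba Bb.
  have [q [Cq [qc qd]]] := goodP _ _ Bc Bd.
  have [r Cr [pr qr]] := both _ _ Cp Cq.
  by rewrite !(fE r)//; [apply: pp_inj| | | |]; do ?[exact: pr.1|exact: qr.1].
exists (PartialPairing subB clB injB) => p Cp; split=> [a pa|a b pa pb] /=.
  by exists p.
exact: fE.
Qed.

Lemma maximal_pp (p0 : partial_pairing) : exists p, pp_extends p0 p /\
  forall q, pp_extends p q -> pp_set q `<=` pp_set p.
Proof.
pose S := {p | pp_extends p0 p}.
pose R (p q : S) := `[< pp_extends (sval p) (sval q) >].
have [||C totC|p pmax] := @ZL_preorder S (exist _ p0 (pp_extends_refl p0)) R.
- by move=> p; apply/asboolP; exact: pp_extends_refl.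
- move=> p q r /asboolP pq /asboolP qr; apply/asboolP.
  exact: pp_extends_trans qr.
- have [[p1 Cp1]|C0] := pselect (C !=set0); last first.
    exists (exist _ p0 (pp_extends_refl p0)) => s Cs.
    by case: C0; exists s.
  have [||q qC] := @pp_chain [set sval p | p in C].
  + by exists (sval p1); exists p1.
  + move=> _ _ [p Cp <-] [q Cq <-].
    by have [/asboolP|/asboolP] := totC _ _ Cp Cq;
      [left|right].
  have p0q : pp_extends p0 q.
    by apply: pp_extends_trans (svalP p1) _; apply: qC; exists p1.
  by exists (exist _ q p0q) => s Cs; apply/asboolP; apply: qC; exists s.
exists (sval p); split=> [|q pq]; first exact: svalP.
have p0q := pp_extends_trans (svalP p) pq.
have /asboolP[//] := pmax (exist _ q p0q) (introT (asboolP _) pq).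
Qed.

End Hessenberg.

Lemma pp_nat (T : pointedType) (A : set T) (i : nat -> T) :
  (forall n, A (i n)) -> injective i ->
  exists p : partial_pairing A, forall n, pp_set p (i n).
Proof.
move=> Ai i_inj; pose j a := xget 0 [set n | i n = a].
have iK n : j (i n) = n.
  rewrite /j; case: xgetP => [m _ /i_inj|none]; first exact.
  by case: (none n).
pose f a b := i (pickle (j a, j b)).
have subR : range i `<=` A by move=> _ [n _ <-].
have clR a b : range i a -> range i b -> range i (f a b).
  by move=> _ _; exists (pickle (j a, j b)).
have injR a b c d : range i a -> range i b -> range i c -> range i d ->
    f a b = f c d -> a = c /\ b = d.
  move=> [a' _ <-] [b' _ <-] [c' _ <-] [d' _ <-] /i_inj.
  by move=> /(pcan_inj pickleK); rewrite !iK => -[-> ->].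
by exists (PartialPairing subR clR injR) => n; exists n.
Qed.

(** If [B := pp_set p] injects into its complement via [h], then [p] extends to
    [B' := B `|` h @` B]: the square of [B'] minus that of [B] consists of three
    copies of the square of [B], that are sent into [h @` B] after being encoded
    in [B] with a tag among [i 0], [i 1], [i 2]. *)
Lemma pp_extend (T : pointedType) (A : set T) (p : partial_pairing A)
    (i : nat -> T) (h : T -> T) : (forall n, pp_set p (i n)) -> injective i ->
  (forall a, pp_set p a -> (A `\` pp_set p) (h a)) -> set_inj (pp_set p) h ->
  exists q, pp_extends p q /\ pp_set q (h (i 0)).
Proof.
move=> Bi i_inj hB h_inj; pose B := pp_set p; pose f := pp_fun p.
have {}h_inj a b : B a -> B b -> h a = h b -> a = b.
  by move=> Ba Bb; apply: h_inj; exact/mem_set.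
pose B' := B `|` (h @` B).
(* The point of [B] of which [a] is a copy. *)
pose l a := if `[< B a >] then a else xget point [set b | B b /\ h b = a].
have lB a : B' a -> B (l a).
  move=> B'a; rewrite /l; case: asboolP => // nBa.
  case: xgetP => [b _ [//]|] none; case: B'a => [//|[b Bb hb]].
  by have := none b; case; split.
have lK a : B' a -> ~ B a -> h (l a) = a.
  move=> B'a nBa; rewrite /l; case: asboolP => // _.
  case: xgetP => [b _ [//]|] none; case: B'a => [//|[b Bb hb]].
  by have := none b; case; split.
have lE a : B a -> l a = a by move=> Ba; rewrite /l; case: asboolP.
have l_inj a c : B' a -> B' c -> `[< B a >] = `[< B c >] -> l a = l c -> a = c.
  move=> B'a B'c.
  have [Ba|nBa] := asboolP (B a); have [Bc|nBc] := asboolP (B c) => //.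
    by rewrite !lE.
  by move=> _ lac; rewrite -(lK a)// lac lK.
pose t a b := i (if `[< B a >] then 0 else if `[< B b >] then 1 else 2).
pose f' a b := if `[< B a >] && `[< B b >] then f a b
               else h (f (t a b) (f (l a) (l b))).
have inB a b : B' a -> B' b -> B (f (t a b) (f (l a) (l b))).
  move=> B'a B'b; exact: pp_closed (Bi _) (pp_closed (lB _ B'a) (lB _ B'b)).
have subB : B' `<=` A.
  by move=> a [|[b /hB[Ab _] <-]] //; exact: pp_sub.
have clB a b : B' a -> B' b -> B' (f' a b).
  move=> B'a B'b; rewrite /f'; case: ifPn => [/andP[/asboolP Ba /asboolP Bb]|_].
    by left; exact: pp_closed.
  by right; exists (f (t a b) (f (l a) (l b))) => //; exact: inB.
have injB a b c d : B' a -> B' b -> B' c -> B' d ->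
    f' a b = f' c d -> a = c /\ b = d.
  move=> B'a B'b B'c B'd; rewrite /f'.
  case: ifPn => [/andP[/asboolP Ba /asboolP Bb]|nab];
    case: ifPn => [/andP[/asboolP Bc /asboolP Bd]|ncd].
  - exact: pp_inj.
  - move=> e; have [_] := hB _ (inB _ _ B'c B'd); rewrite -e; case.
    exact: pp_closed.
  - move=> e; have [_] := hB _ (inB _ _ B'a B'b); rewrite e; case.
    exact: pp_closed.
  move=> /(h_inj _ _ (inB _ _ B'a B'b) (inB _ _ B'c B'd)).
  have Bl x y : B' x -> B' y -> B (f (l x) (l y)).
    by move=> B'x B'y; apply: pp_closed; exact: lB.
  move=> /(pp_inj (Bi _) (Bl _ _ B'a B'b) (Bi _) (Bl _ _ B'c B'd))[/i_inj tt].
  move=> /(pp_inj (lB _ B'a) (lB _ B'b) (lB _ B'c) (lB _ B'd))[la lb].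
  have [Eac Ebd] : `[< B a >] = `[< B c >] /\ `[< B b >] = `[< B d >].
    by move: tt nab ncd; case: `[< B a >]; case: `[< B b >];
      case: `[< B c >]; case: `[< B d >].
  by split; [exact: l_inj Eac la|exact: l_inj Ebd lb].
exists (PartialPairing subB clB injB); split; last first.
  by apply: or_intror; exists (i 0) => //; exact: Bi.
split=> [a|a b] /=; first by left.
by move=> Ba Bb; rewrite /f'; case: asboolP => //; case: asboolP.
Qed.

(** Hessenberg's theorem. Take a maximal partial pairing. By [pp_extend], its
    set [B] does not inject into [A `\` B], so by comparability [A `\` B]
    injects into [B]. Hence so does [A], as two copies of [B] fit in [B] via the
    pairing, and the square of [A] embeds in that of [B], hence in [B]. *)
Lemma card_le_square (A : set (set cantor_space)) :
  infinite_set A -> A `*` A #<= A.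
Proof.
move=> /infiniteP/pcard_leP[i].
have Ai n : A (i n) by exact: funS.
have i_inj : injective i by move=> m n; apply: inj; exact: in_setT.
have [p0 p0i] := pp_nat Ai i_inj.
have [p [[p0p _] pmax]] := maximal_pp p0.
have pi n : pp_set p (i n) by exact: p0p.
have [/pcard_leP[h]|/pcard_leP[h]] :=
  card_le_cases (pp_set p) (A `\` pp_set p); last first.
  pose u a :=
    if `[< pp_set p a >] then pp_fun p (i 0) a else pp_fun p (i 1) (h a).
  have hB a : A a -> ~ pp_set p a -> pp_set p (h a).
    by move=> Aa nBa; apply: (@funS _ _ _ _ h); split.
  have uB a : A a -> pp_set p (u a).
    move=> Aa; rewrite /u; case: asboolP => [Ba|nBa]; apply: pp_closed => //.
    exact: hB.
  have u_inj a b : A a -> A b -> u a = u b -> a = b.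
    move=> Aa Ab; rewrite /u.
    case: asboolP => [Ba|nBa]; case: asboolP => [Bb|nBb] e.
    - by have [] := pp_inj (pi _) Ba (pi _) Bb e.
    - by have [/i_inj] := pp_inj (pi _) Ba (pi _) (hB _ Ab nBb) e.
    - by have [/i_inj] := pp_inj (pi _) (hB _ Aa nBa) (pi _) Bb e.
    have [_] := pp_inj (pi _) (hB _ Aa nBa) (pi _) (hB _ Ab nBb) e.
    by apply: inj; apply/mem_set; split.
  apply/pcard_leP/injfunPex; exists (fun x => pp_fun p (u x.1) (u x.2)).
    by move=> [a b] [/= Aa Ab]; apply: pp_sub (pp_closed _ _); exact: uB.
  move=> [a b] [c d] /set_mem[/= Aa Ab] /set_mem[/= Ac Ad] e.
  have [ac bd] := pp_inj (uB _ Aa) (uB _ Ab) (uB _ Ac) (uB _ Ad) e.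
  by rewrite (u_inj a c)// (u_inj b d).
have [||q [pq qh]] := pp_extend pi i_inj (h := h).
- by move=> a pa; exact: funS.
- exact: inj.
have [_] : (A `\` pp_set p) (h (i 0)) by exact: funS.
by case; exact: pmax qh.
Qed.

(** * Attained cardinals *)

Lemma card_le_card T U (A : set T) (B : set U) :
  A #<= B -> (card A <= card B)%O.
Proof.
by move=> AB; have [fB|/card_leq_top//] := pselect (fits B); rewrite card_leE.
Qed.

Lemma least_le (S : set cardinal) c : S c -> (least S <= c)%O.
Proof. by move=> Sc; apply: (leastP _).2 => //; exists c. Qed.

Lemma least_in (S : set cardinal) : S !=set0 -> S (least S).
Proof. by move=> /leastP[]. Qed.

Lemma finite_not_dominating (F : set (nat -> nat)) : finite_set F ->
  ~ forall f, exists2 g, F g & le_star f g.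
Proof.
move=> /finite_seqP[s ->] /(_ (fun n => (\sum_(g <- s) g n).+1)).
move=> [g gs [N _ /(_ N (leqnn N))]]; apply/negP; rewrite -ltnNge ltnS.
by rewrite (big_rem g)//= leq_addr.
Qed.

Lemma card_le_setXdep (T U : Type) (V : pointedType) (D : set T)
    (C : T -> set U) (K : set V) :
  D #<= K -> (forall t, D t -> C t #<= K) -> D `*`` C #<= K `*` K.
Proof.
move=> /pcard_leP/injfunPex[f fK f_inj] CK.
have /choice[h hP] t : exists h : U -> V, D t ->
    set_fun (C t) K h /\ set_inj (C t) h.
  have [Dt|nDt] := pselect (D t); last by exists (fun=> point).
  by have /pcard_leP/injfunPex[h hK h_inj] := CK _ Dt; exists h.
apply/pcard_leP/injfunPex; exists (fun x => (f x.1, h x.1 x.2)).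
  by move=> [t u] [/= Dt Ctu]; split=> /=; [exact: fK|exact: (hP _ Dt).1].
move=> [t u] [t' u'] /set_mem[/= Dt Cu] /set_mem[/= Dt' Cu'] [ff].
have tt' : t = t' by apply: f_inj ff; exact/mem_set.
rewrite -{}tt' in Dt' Cu' *.
by move=> hh; congr pair; apply: (hP _ Dt).2 hh; exact/mem_set.
Qed.

Lemma card_rep (c : cardinal) : card_class c !=set0 ->
  exists K : set (set cantor_space), c = card K.
Proof.
have [T [A ->]] := card_surj c => /fitsP fA.
have [K /= KA] := (fitsP _).1 fA; exists K.
by apply/card_eqE => //; rewrite card_eq_sym.
Qed.

Section MatchingIdeal.
Variable I : interval_partition.

(** The opposite point agrees with [y] nowhere, and blocks are nonempty. *)
Lemma notin_matching_set (J : interval_partition) y :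
  ~ matching_set I J y (fun i => ~~ y i).
Proof.
move=> [N _ /(_ N (leqnn N))[k [_ /(_ _ (block_first I k))]]].
by case: (y _).
Qed.

Lemma ideal_match_proper : ~ ideal_match I setT.
Proof.
by move=> [J [y /(_ (fun i => ~~ y i) Logic.I)]]; exact: notin_matching_set.
Qed.

Lemma matching_set_in J y : ideal_match I (matching_set I J y).
Proof. by exists J, y. Qed.

(** The blocks of this partition are unions of blocks of [I], and each of them
    contains a block of [K]. *)
Definition common_coarsening (K : interval_partition) : interval_partition :=
  coarsening I (fun n => ends K n.+1).

Lemma common_coarsening_sub (K : interval_partition) n :
  exists k, K k `<=` common_coarsening K n.
Proof.
exists (ends (common_coarsening K) n); apply/sub_block_ends.
by split; [exact: ends_ge|exact: coarsening_ge].
Qed.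

Lemma mem_ideal_match : \bigcup_(X in ideal_match I) X = setT.
Proof.
apply/seteqP; split=> // y _; exists (matching_set I (common_coarsening I) y).
  exact: matching_set_in.
by apply: matching_set_refl; exact: common_coarsening_sub.
Qed.

Lemma add_attained : exists2 C,
  C `<=` ideal_match I /\ ~ ideal_match I (\bigcup_(X in C) X)
  & card C = add (ideal_match I).
Proof.
apply: (@least_in [set card C | C in _]).
exists (card (ideal_match I)); exists (ideal_match I) => //; split=> //.
by rewrite mem_ideal_match; exact: ideal_match_proper.
Qed.

Lemma cov_attained : exists2 C,
  C `<=` ideal_match I /\ \bigcup_(X in C) X = setT
  & card C = cov (ideal_match I).
Proof.
apply: (@least_in [set card C | C in _]).
exists (card (ideal_match I)); exists (ideal_match I) => //; split=> //.
exact: mem_ideal_match.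
Qed.

Lemma non_attained :
  exists2 A, ~ ideal_match I A & card A = non (ideal_match I).
Proof.
apply: (@least_in [set card A | A in _]).
exists (card [set: cantor_space]); exists setT => //.
exact: ideal_match_proper.
Qed.

Lemma cof_attained : exists2 C,
  C `<=` ideal_match I /\ forall X, ideal_match I X -> exists2 Y, C Y & X `<=` Y
  & card C = cof (ideal_match I).
Proof.
apply: (@least_in [set card C | C in _]).
exists (card (ideal_match I)); exists (ideal_match I) => //; split=> // X IX.
by exists X.
Qed.

End MatchingIdeal.

Lemma bounding_attained : exists2 F : set (nat -> nat),
  ~ exists g, forall f, F f -> le_star f g & card F = bounding.
Proof.
apply: (@least_in [set card F | F in _]).
exists (card [set: nat -> nat]); exists setT => // -[g].
move=> /(_ (fun n => (g n).+1) Logic.I)[N _ /(_ N (leqnn N))].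
by rewrite /= ltnn.
Qed.

Lemma dominating_attained : exists2 F : set (nat -> nat),
  forall f, exists2 g, F g & le_star f g & card F = dominating.
Proof.
apply: (@least_in [set card F | F in _]).
exists (card [set: nat -> nat]); exists setT => // f; exists f => //.
by exists 0.
Qed.

Lemma minnon_attained :
  exists2 K : interval_partition, True & non (ideal_match K) = minnon.
Proof.
apply: (@least_in (range _)).
by exists (non (ideal_match singletons)); exists singletons.
Qed.

(** * Additivity *)

Lemma ideal_match_pair (I : interval_partition) : exists J y,
  forall X, ideal_match I X -> X `<=` matching_set I (J X) (y X).
Proof.
have /choice[p pP] X : exists p : interval_partition * cantor_space,
    ideal_match I X -> X `<=` matching_set I p.1 p.2.
  have [[J [y XJ]]|nX] := pselect (ideal_match I X); first by exists (J, y).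
  by exists (I, point).
by exists (fst \o p), (snd \o p).
Qed.

(** Given fewer than [bounding] and [minnon] sets [matching_set I (J X) (y X)],
    a single [K] dominates all the [J X], and all the [y X] then lie in a single
    [matching_set K J' y']; apply [matching_set_trans]. *)
Lemma min_le_add (I : interval_partition) :
  (Order.min bounding minnon <= add (ideal_match I))%O.
Proof.
have [C [CI CN] <-] := add_attained I.
have [J [y JyP]] := ideal_match_pair I.
rewrite ge_min; apply/orP.
pose F := [set (fun n => ends (J X) n.+1) | X in C].
have [[g gF]|unb] := pselect (exists g, forall f, F f -> le_star f g);
    last first.
  left; apply: le_trans (card_le_card (card_image_le _ C)).
  by apply: least_le; exists F.
pose K := coarsening I g.
have [[J' [y' yJ']]|nK] := pselect (ideal_match K (y @` C)); last first.
  right; apply: le_trans (card_le_card (card_image_le y C)).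
  apply: (@le_trans _ _ (non (ideal_match K))).
    by apply: least_le; exists K.
  by apply: least_le; exists (y @` C).
case: CN; exists J', y' => x [X CX Xx].
apply: (@matching_set_trans I (J X) K J' (y X) y').
- by apply: le_star_dominated; apply: gF; exists X.
- by apply: yJ'; exists X.
- exact: JyP (CI _ CX) _ Xx.
Qed.

Lemma matching_subset_le_star (I J' : interval_partition)
    (y y' : cantor_space) (f : nat -> nat) :
  matching_set I (coarsening I f) y `<=` matching_set I J' y' ->
  le_star f (fun n => ends (double J') n.+1).
Proof.
move=> sub; apply: dominated_le_star.
exact: matching_dominated (matching_subset (refines_coarsening _ _) sub).
Qed.

Lemma matching_subset_common (I K J' : interval_partition)
    (y y' : cantor_space) :
  matching_set I (common_coarsening I K) y `<=` matching_set I J' y' ->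
  matching_set K (double J') y' y.
Proof.
move=> sub; apply: matching_set_antimono (common_coarsening_sub I K) _ _.
exact: matching_subset (refines_coarsening _ _) sub.
Qed.

Lemma add_le_bounding (I : interval_partition) :
  (add (ideal_match I) <= bounding)%O.
Proof.
have [F unb <-] := bounding_attained.
pose S f := matching_set I (coarsening I f) point.
apply: le_trans (card_le_card (card_image_le S F)); apply: least_le.
exists (S @` F) => //; split=> [_ [f _ <-]|[J [y SJ]]].
  exact: matching_set_in.
apply: unb; exists (fun n => ends (double J) n.+1) => f Ff.
apply: (@matching_subset_le_star I J point y) => x Sx.
by apply: SJ; exists (S f) => //; exists f.
Qed.

Lemma add_le_minnon (I : interval_partition) :
  (add (ideal_match I) <= minnon)%O.
Proof.
have [K _ <-] := minnon_attained.
have [A AK <-] := non_attained K.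
pose S y := matching_set I (common_coarsening I K) y.
apply: le_trans (card_le_card (card_image_le S A)); apply: least_le.
exists (S @` A) => //; split=> [_ [y _ <-]|[J [y' SJ]]].
  exact: matching_set_in.
apply: AK; exists (double J), y' => y Ay.
apply: (@matching_subset_common I) => x Sx.
by apply: SJ; exists (S y) => //; exists y.
Qed.

Lemma add_ideal_match (I : interval_partition) :
  add (ideal_match I) = Order.min bounding minnon.
Proof.
apply/le_anti; rewrite min_le_add le_min.
by rewrite add_le_bounding add_le_minnon.
Qed.

(** * Cofinality *)

Lemma dominating_le_cof (I : interval_partition) :
  (dominating <= cof (ideal_match I))%O.
Proof.
have [C [CI Ccof] <-] := cof_attained I.
have [J [y JyP]] := ideal_match_pair I.
pose g X n := ends (double (J X)) n.+1.
apply: le_trans (card_le_card (card_image_le g C)); apply: least_le.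
exists (g @` C) => // f.
have [X CX SX] := Ccof _ (matching_set_in I (coarsening I f) point).
exists (g X); first by exists X.
apply: (@matching_subset_le_star I (J X) point (y X)).
exact: subset_trans SX (JyP _ (CI _ CX)).
Qed.

Lemma cov_le_cof (I K : interval_partition) :
  (cov (ideal_match K) <= cof (ideal_match I))%O.
Proof.
have [C [CI Ccof] <-] := cof_attained I.
have [J [y JyP]] := ideal_match_pair I.
pose S X := matching_set K (double (J X)) (y X).
apply: le_trans (card_le_card (card_image_le S C)); apply: least_le.
exists (S @` C) => //; split=> [_ [X _ <-]|]; first exact: matching_set_in.
apply/seteqP; split=> // z _.
have [X CX SX] := Ccof _ (matching_set_in I (common_coarsening I K) z).
exists (S X); first by exists X.
apply: (@matching_subset_common I).
exact: subset_trans SX (JyP _ (CI _ CX)).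
Qed.

Lemma supcovP :
  supremums (range (fun I => cov (ideal_match I))) supcov.
Proof.
apply: supcardinalP; exists (cov (ideal_match singletons)).
by exists singletons.
Qed.

(** The dual of [min_le_add]: for each [g] in a dominating family, cover the
    space by matching sets for [coarsening I g]; the pairs [(J', y')] that
    occur in one of these covers give a cofinal family. Its size is at most
    the square of the maximum, which is infinite. *)
Lemma cof_le_max (I : interval_partition) :
  (cof (ideal_match I) <= Order.max dominating supcov)%O.
Proof.
set c := Order.max _ _.
have [F Fdom Fd] := dominating_attained.
have Fc : (card F <= c)%O by rewrite Fd le_max lexx.
have covc K : (cov (ideal_match K) <= c)%O.
  by rewrite le_max; apply/orP; right; apply: supcovP.1; exists K.
(* A cardinal with empty class is above all the others. *)
have [/card_rep[A cA]|c0] := pselect (card_class c !=set0); last first.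
  by apply/asboolP => D cD; case: c0; exists D.
have fA : fits A by exact: fits_set.
rewrite cA card_leE// in Fc.
have infA : infinite_set A.
  move=> /(card_le_finite Fc) finF.
  exact: finite_not_dominating finF Fdom.
pose K g := coarsening I g.
have /choice[C CP] g : exists C : set (set cantor_space),
    [/\ C `<=` ideal_match (K g), \bigcup_(X in C) X = setT & C #<= A].
  have [C [CI Ccov] Ccard] := cov_attained (K g).
  by exists C; split=> //; rewrite -card_leE// -cA Ccard; exact: covc.
have /choice[J /choice[y JyP]] g := ideal_match_pair (K g).
pose S (x : (nat -> nat) * set cantor_space) :=
  matching_set I (J x.1 x.2) (y x.1 x.2).
pose Z := F `*`` C.
have ZA : Z #<= A.
  apply: card_le_trans (card_le_square infA).
  by apply: card_le_setXdep => // g _; have [] := CP g.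
rewrite cA; apply: (@le_trans _ _ (card Z)); last exact: card_le_card.
apply: le_trans (card_le_card (card_image_le S Z)); apply: least_le.
exists (S @` Z) => //; split=> [_ [x _ <-]|X [J1 [y1 XJ1]]].
  exact: matching_set_in.
have [g Fg J1g] := Fdom (fun n => ends J1 n.+1).
have [CI Ccov _] := CP g.
have [Y CY Yy1] : (\bigcup_(X in C g) X) y1 by rewrite Ccov.
exists (S (g, Y)); first by exists (g, Y).
apply: subset_trans XJ1 _.
apply: (@matching_set_trans I J1 (K g) _ y1).
  exact: le_star_dominated.
exact: JyP (CI _ CY) _ Yy1.
Qed.

Lemma cof_ideal_match (I : interval_partition) :
  cof (ideal_match I) = Order.max dominating supcov.
Proof.
apply/le_anti; rewrite cof_le_max ge_max dominating_le_cof /=.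
by apply: supcovP.2 => _ [K _ <-]; exact: cov_le_cof.
Qed.

Theorem theoremB (I : interval_partition) :
  [/\ add (ideal_match I) = add ideal_meager,
      add ideal_meager = Order.min bounding minnon,
      cof (ideal_match I) = cof ideal_meager &
      cof ideal_meager = Order.max dominating supcov].
Proof.
by rewrite ideal_meagerE !add_ideal_match !cof_ideal_match.
Qed.
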